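(* Let $k$ and $n$ be positive integers, and let $a,b$ be positive integers with $b\in\{a-2,a-1\}$ and $a+b<n$. If $\sigma$ is a uniformly random bijection from $\{1,\ldots,n\}$ to $\{k,k+1,\ldots,n+k-1\}$, then $\Pr[D_{a,b}(\sigma)=0]<\frac1n$.
   Context: For a bijection $\sigma:\{1,\ldots,n\}\to\{k,\ldots,n+k-1\}$ (a ''random permutation of $\{k,\ldots,n+k-1\}$'') and positive integers $a,b$ with $a+b<n$, define $D_{a,b}(\sigma)=\sum_{i=1}^{a}\sigma(i)-\sum_{i=a+1}^{a+b}\sigma(i)$. *)

(* Defs.v *)
From HB Require Import structures.
From mathcomp Require Import all_boot all_order all_algebra.

Set Implicit Arguments.
Unset Strict Implicit.
Unset Printing Implicit Defensive.

Import Order.TTheory GRing.Theory Num.Theory.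

Local Open Scope ring_scope.

(* Bijections from {1, ..., n} to {k, ..., n+k-1}.  The domain is 0-based:
   i : 'I_n stands for the element i+1 of {1, ..., n}.  Values are not shifted:
   elements of 'I_(n + k) are at most n+k-1. *)
Definition bijections (n k : nat) : {set {ffun 'I_n -> 'I_(n + k)}} :=
  [set s : {ffun 'I_n -> 'I_(n + k)} |
     injectiveb s && (s @: [set: 'I_n] == [set j : 'I_(n + k) | (k <= j)%N])].

(* With the 0-based domain, sigma(1), ..., sigma(a) are the values at
   0 <= i < a, and sigma(a+1), ..., sigma(a+b) those at a <= i < a + b. *)
Definition Dstat (n k a b : nat) (s : {ffun 'I_n -> 'I_(n + k)}) : int :=
  \sum_(i < n | (i < a)%N) (s i : nat)%:Z
    - \sum_(i < n | (a <= i < a + b)%N) (s i : nat)%:Z.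

Definition unif_pr (T : finType) (Omega : {set T}) (E : pred T) : rat :=
  #|[set x in Omega | E x]|%:R / #|Omega|%:R.

(* Main.v *)
Require Import Defs.
From HB Require Import structures.
From mathcomp Require Import all_boot all_order all_fingroup all_algebra.
From mathcomp Require Import zify ring.

(* Read a bijection as a word w over the values, with w(v) = 1, -1 or 0 as v is
   taken in the first a positions, in the next b, or elsewhere, so that
   D = sum_v w(v) (v + k).  Rotating the word by h changes D by -(a - b) h
   modulo n.  If a - b is invertible modulo n, exactly a proportion 1/n of the
   words has n | D, and some word has n | D but D > 0, whence the strict inequality.
   The remaining case is a - b = 2 and n = 2m, where the proportion of words with
   n | D is 1/m times that of the words with D even.  Match the values in pairs of
   opposite parity.  Exchanging the two values of a pair exactly one of which
   has weight 0 changes the parity of D, so the words having such a pair (the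
   "unpaired" ones) are evenly split.  The other words may all have D even, but
   among them at least half of those with n | D have D <> 0:
   - m odd, matching v with v + m: if D is even then some pair has weights
     (1, -1), and exchanging it changes D by n or -n;
   - m even, matching 2i with 2i + 1: since the weights add up to 2, some block
     {2i, 2i + 1} has a total weight different from that of {2i + m, 2i + 1 + m},
     and exchanging these blocks changes D by a nonzero multiple of n. Here
     the proportion of n | D among paired words is computed with rotations by 2
     and the flip of a block (1, -1), which changes D by 2 modulo 4. *)

Set Implicit Arguments.
Unset Strict Implicit.
Unset Printing Implicit Defensive.

Import Order.TTheory GRing.Theory Num.Theory.

Local Open Scope ring_scope.

(** * Counting by a rotation, by an involution, and the final arithmetic *)

Lemma card_split (T : finType) (P Y : pred T) :
  #|[set x | P x]| = (#|[set x | Y x && P x]| + #|[set x | ~~ Y x && P x]|)%N.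
Proof.
rewrite -(cardsID [set x | Y x]); congr (_ + _)%N; apply: eq_card => x.
  by rewrite !inE andbC.
by rewrite !inE.
Qed.

(** Each application of [rho] lowers [f] by 1 modulo [q], so it carries every residue class of [f]
    within [Y] onto another one, and the [q] classes are equally large. *)
Lemma rotation_count (T : finType) (rho : T -> T) (Y : pred T) (f : T -> int)
    (q : nat) :
  (0 < q)%N -> injective rho -> (forall x, Y (rho x) = Y x) ->
  (forall x, Y x -> (q%:Z %| f (rho x) - f x + 1)%Z) ->
  (q * #|[set x | Y x && (q%:Z %| f x)%Z]|)%N = #|[set x | Y x]|.
Proof.
move=> q0 rho_inj Yrho frho.
(* [c j] is the size of the class of [j]: the [x] in [Y] with [f x] congruent to [j] modulo [q]. *)
pose c (j : nat) := (\sum_x (Y x && (q%:Z %| (f x - j%:Z)%R)%Z : nat))%N.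
have cE j : c j = c 0%N.
  elim: j => // j <-; rewrite /c [in RHS](reindex_inj rho_inj) /=.
  apply: eq_bigr => x _; rewrite Yrho; case Yx: (Y x) => //=.
  have := frho x Yx; set u := f _; set v := f _ => h.
  suff -> : (q%:Z %| v - j.+1%:Z)%Z = (q%:Z %| u - j%:Z)%Z by [].
  have -> : u - j%:Z = (u - v + 1) + (v - j.+1%:Z) by lia.
  by rewrite (rpredDl _ h).
have -> : (q * #|[set x | Y x && (q%:Z %| f x)%Z]| = \sum_(j < q) c j)%N.
  rewrite (eq_bigr (fun=> c 0%N)); last by move=> j _; apply: cE.
  rewrite sum_nat_const card_ord /c; congr (_ * _)%N.
  by rewrite -sum1dep_card big_mkcond /=; apply: eq_bigr => x _; rewrite subr0; case: (_ && _).
rewrite /c exchange_big /= -sum1dep_card [in RHS]big_mkcond /=.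
apply: eq_bigr => x _; case Yx: (Y x); last by rewrite big1.
have rlt : (`|(f x %% q%:Z)%Z| < q)%N by lia.
rewrite (bigD1 (Ordinal rlt)) //= big1 ?addn0.
  suff -> : (q%:Z %| f x - `|(f x %% q%:Z)%Z|%:Z)%Z by [].
  rewrite gez0_abs; last by rewrite modz_ge0; lia.
  by rewrite {1}(divz_eq (f x) q%:Z) addrK dvdz_mull.
move=> j /eqP hj; apply/eqP; rewrite eqb0; apply/negP => h; apply: hj.
apply: val_inj => /=; have := ltn_ord j => jq.
have /eqP : (f x == j%:Z %[mod q%:Z])%Z by rewrite eqz_mod_dvd.
rewrite [in RHS]modz_small => [->|]; lia.
Qed.

(** Since [act i] does not change the set [Q x] of admissible indices, the index picked at [x] is
    picked again at its image. Acting by the picked index is therefore an involution, and it injects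
    the part of [R] in [G] into the part outside [G]. *)
Lemma toggle_half (T I : finType) (act : I -> T -> T) (Q : T -> pred I)
    (R G : pred T) :
  (forall i x, act i (act i x) = x) ->
  (forall i j x, Q (act i x) j = Q x j) ->
  (forall i x, R x -> Q x i -> R (act i x)) ->
  (forall i x, R x -> Q x i -> G x -> ~~ G (act i x)) ->
  (forall x, R x -> G x -> exists i, Q x i) ->
  (2 * #|[set x | R x && G x]| <= #|[set x | R x]|)%N.
Proof.
move=> actK Qact Ract Gact exQ.
pose phi x := if [pick i | Q x i] is Some i then act i x else x.
have phiK : involutive phi.
  move=> x; rewrite /phi; case E: [pick i | Q x i] => [i|]; last by rewrite E.
  have -> : [pick j | Q (act i x) j] = [pick j | Q x j].
    by apply: eq_pick => j; apply: Qact.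
  by rewrite E actK.
have sub : phi @: [set x | R x && G x] \subset [set x | R x && ~~ G x].
  apply/subsetP => y /imsetP[x xin ->]; move: xin.
  rewrite inE => /andP[Rx Gx]; rewrite inE /phi; case: pickP => [i Qi|h]; first by rewrite Ract ?Gact.
  by have [i] := exQ x Rx Gx; rewrite h.
have := subset_leq_card sub; rewrite card_imset; last exact: inv_inj phiK.
rewrite (card_split R G) (eq_card (B := [set x | G x && R x])).
  rewrite (eq_card (A := [set x | R x && ~~ G x]) (B := [set x | ~~ G x && R x])).
    lia.
  by move=> x; rewrite !inE andbC.
by move=> x; rewrite !inE andbC.
Qed.

Lemma sum_halves (p : nat) (F : nat -> int) :
  \sum_(0 <= j < 2 * p) F j = \sum_(0 <= i < p) (F i + F (i + p)%N).
Proof.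
rewrite mul2n -addnn (big_cat_nat (leq0n p) (leq_addr p p)) /= big_split.
by congr (_ + _); rewrite -{1}[p]add0n big_addn addnK.
Qed.

(** [x] and [y] count unpaired and paired words, [N] all of them. A suffix [e] restricts to D even,
    [0] to n | D, [g] to D = 0, [G] to D = 0 or D = D(t0); [e], [z0], [g] alone are totals. Then m
    x0 = xe gives 2m xg <= x, and 2m yg < 2m yG <= ye <= y. *)
Lemma antipodal_arith (m N x y xe ye e x0 y0 z0 xg yg g yG : nat) :
  (0 < m)%N -> (2 * xe <= x)%N -> (2 * yG <= y0)%N -> (yg < yG)%N ->
  (xg <= x0)%N -> (m * y0)%N = ye -> (m * z0)%N = e -> (ye <= y)%N ->
  (x + y)%N = N -> e = (xe + ye)%N -> z0 = (x0 + y0)%N -> g = (xg + yg)%N ->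
  (2 * m * g < N)%N.
Proof. nia. Qed.

(** Same letters; [y4] and [y4'] split [ye] by D being 0 or 2 modulo 4. The chain is 2m g < 2m x0 +
    m y0 = 2e - 2 y4 = 2 xe + 2 y4' <= x + ye <= N. *)
Lemma adjacent_arith (m q N x y xe ye y4 y4' e x0 y0 z0 xg yg g : nat) :
  (0 < q)%N -> m = (2 * q)%N -> (2 * xe <= x)%N -> (2 * y4' <= ye)%N ->
  (2 * yg <= y0)%N -> (xg < x0)%N -> (q * y0)%N = y4 -> (m * z0)%N = e ->
  (ye <= y)%N -> (x + y)%N = N -> e = (xe + ye)%N -> z0 = (x0 + y0)%N ->
  g = (xg + yg)%N -> ye = (y4 + y4')%N -> (2 * m * g < N)%N.
Proof. nia. Qed.

(** * Words, exchanges of two values, rotations *)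

Section WeightedPermutations.

Variables (n' k : nat).
Local Notation n := n'.+1.
Variable wt : 'I_n -> int.

(** [t] sends values, counted from 0, to positions: it is the inverse of the bijection, and [wt]
    weighs positions. *)
Definition wsum (t : 'S_n) : int := \sum_v wt (t v) * (v + k)%N%:Z.

(** Indexed by [nat] to allow free index arithmetic; [inord] sends indices from [n] on to 0. *)
Definition word (t : 'S_n) (j : nat) : int := wt (t (inord j)).

Lemma wsum_word t : wsum t = \sum_(0 <= j < n) word t j * (j + k)%N%:Z.
Proof. by rewrite big_mkord; apply: eq_bigr => v _; rewrite /word inord_val. Qed.

Lemma sum_word t : \sum_(0 <= j < n) word t j = \sum_i wt i.
Proof.
rewrite [RHS](reindex_inj (@perm_inj _ t)) /= big_mkord.
by apply: eq_bigr => v _; rewrite /word inord_val.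
Qed.

(** The left factor acts first, so values are exchanged, not positions. *)
Definition swap (x y : nat) (t : 'S_n) : 'S_n :=
  (tperm (inord x : 'I_n) (inord y) * t)%g.

Lemma swapK x y : involutive (swap x y).
Proof. by move=> t; rewrite /swap mulgA tperm2 mul1g. Qed.

Lemma word_swap x y t j : (x < n)%N -> (y < n)%N -> (j < n)%N ->
  word (swap x y t) j = word t (if j == x then y else if j == y then x else j).
Proof.
move=> hx hy hj; rewrite /word /swap permM; congr (wt (t _)).
have inordE u v : (u < n)%N -> (v < n)%N ->
    (inord u == inord v :> 'I_n) = (u == v).
  by move=> hu hv; rewrite -val_eqE /= !inordK.
case: tpermP => [/eqP|/eqP|/eqP + /eqP]; rewrite !inordE //.
- by move=> ->.
- by move=> /eqP ->; case: eqP => [->|_] //; rewrite eqxx.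
- by move=> /negbTE -> /negbTE ->.
Qed.

Lemma wsum_swap x y t : (x < n)%N -> (y < n)%N ->
  wsum (swap x y t) = wsum t + (word t x - word t y) * (y%:Z - x%:Z).
Proof.
move=> hx hy; case: (eqVneq x y) => [->|nxy].
  by rewrite /swap tperm1 mul1g; ring.
have nxy' : (inord y : 'I_n) != inord x.
  by rewrite -val_eqE /= !inordK // eq_sym.
rewrite /wsum (bigD1 (inord x)) //= (bigD1 (inord y)) //=.
rewrite [in RHS](bigD1 (inord x)) //= [in RHS](bigD1 (inord y)) //=.
rewrite /swap /word !permM tpermL tpermR !inordK //.
rewrite (eq_bigr (fun v => wt (t v) * (v + k)%N%:Z)).
  by rewrite !PoszD; ring.
by move=> v /andP[vx vy]; rewrite permM tpermD // eq_sym.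
Qed.

Definition rot_perm (h : 'I_n) : 'S_n := perm (@addrI _ h).

Lemma word_rot h t j : (j < n)%N ->
  word (rot_perm h * t)%g j = word t ((h + j) %% n).
Proof.
move=> hj; rewrite /word permM permE; congr (wt (t _)).
by apply: val_inj; rewrite /= !inordK ?ltn_mod.
Qed.

(** The weight of [(h + v) %% n] moves to [v], and v - (h + v mod n) + h is a multiple of n. *)
Lemma wsum_rot h t :
  (n%:Z %| wsum (rot_perm h * t)%g - wsum t + (\sum_i wt i) * h%:Z)%Z.
Proof.
(* Reindexing gives all three sums the common factor [wt (t (h + v))]. *)
rewrite /wsum [X in _ - X](reindex_inj (@addrI _ h)) /=.
rewrite [X in X * _](reindex_inj (@perm_inj _ t)) /=.
rewrite [X in X * _](reindex_inj (@addrI _ h)) /=.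
rewrite big_distrl /= -sumrB -big_split /=.
apply: rpred_sum => v _; rewrite permM permE -mulrBr -mulrDr.
apply: dvdz_mull => /=; have := divn_eq (h + v) n => E.
suff -> : (v + k)%N%:Z - ((h + v) %% n + k)%N%:Z + h%:Z =
          ((h + v) %/ n)%N%:Z * n%:Z by exact: dvdz_mull.
by nia.
Qed.

(** The rotation lowers D by [c] modulo [n], hence D / c by 1 modulo [q] where c | D. Total weight 2
    gives c = 2 and c = 4 with [h] equal to 1 and 2. *)
Lemma wsum_rot_count (c q : nat) (h : 'I_n) (Y : pred 'S_n) :
  n = (c * q)%N -> (n%:Z %| (\sum_i wt i) * h%:Z - c%:Z)%Z ->
  (forall t, Y (rot_perm h * t)%g = Y t) ->
  (q * #|[set t | Y t && (n%:Z %| wsum t)%Z]|)%N =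
  #|[set t | Y t && (c%:Z %| wsum t)%Z]|.
Proof.
move=> nE hc Yrot; have c0 : (0 < c)%N by lia.
have q0 : (0 < q)%N by lia.
have nZ : n%:Z = q%:Z * c%:Z by rewrite -PoszM nE mulnC.
have step t : exists z, wsum (rot_perm h * t)%g = wsum t - c%:Z + z * q%:Z * c%:Z.
  have /dvdzP[z1 E1] := wsum_rot h t; have /dvdzP[z2 E2] := hc.
  exists (z1 - z2); move: E1 E2; rewrite nZ.
  move: (wsum _) (wsum t) ((\sum_i wt i) * h%:Z) => u v w E1 E2.
  have -> : u = (u - v + w) - (w - c%:Z) + v - c%:Z by ring.
  by rewrite E1 E2; ring.
have Y'rot t : Y (rot_perm h * t)%g && (c%:Z %| wsum (rot_perm h * t)%g)%Z =
               Y t && (c%:Z %| wsum t)%Z.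
  rewrite Yrot; congr (_ && _); have [z ->] := step t.
  by rewrite (rpredDr _ (dvdz_mull _ (dvdzz _))) (rpredBr _ (dvdzz _)).
rewrite -(rotation_count q0 (mulgI (rot_perm h)) Y'rot
   (f := fun t => (wsum t %/ c%:Z)%Z)).
  congr (q * _)%N; apply: eq_card => t; rewrite !inE -andbA; congr (_ && _).
  case: (boolP (c%:Z %| wsum t)%Z) => /= [/dvdzP[e ->]|].
    rewrite mulzK ?nZ; last by lia.
    by rewrite dvdz_mul2r; lia.
  apply: contraNF; apply: dvdz_trans.
  by rewrite nZ dvdz_mull.
move=> t /andP[_ /dvdzP[e E]]; have [z ->] := step t; rewrite E.
have -> : e * c%:Z - c%:Z + z * q%:Z * c%:Z = (e - 1 + z * q%:Z) * c%:Z by ring.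
rewrite !mulzK; try lia.
by rewrite (_ : _ - _ + _ = z * q%:Z) ?dvdz_mull //; ring.
Qed.

Lemma zero_bound_coprime (h : 'I_n) t0 :
  (n%:Z %| (\sum_i wt i) * h%:Z - 1)%Z ->
  (n%:Z %| wsum t0)%Z -> wsum t0 != 0 ->
  (n * #|[set t | wsum t == 0%R]| < #|{: 'S_n}|)%N.
Proof.
move=> hc nD0 D0.
have := @wsum_rot_count 1 n h xpredT (esym (mul1n n)) hc (fun=> erefl).
rewrite [X in _ = X -> _](_ : _ = #|{: 'S_n}|); last first.
  by apply: eq_card => t; rewrite !inE dvd1z.
move=> <-; rewrite ltn_mul2l /=; apply: proper_card; apply/properP; split.
  by apply/subsetP => t; rewrite !inE => /eqP ->; rewrite dvdz0.
by exists t0; rewrite !inE ?nD0.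
Qed.

(** * Total weight 2 and n = 2m: pairs of values and the parity of D *)

Hypothesis wt3 : forall i, [\/ wt i = 0, wt i = 1 | wt i = - 1].
Hypothesis wt_sum : \sum_i wt i = 2.

Lemma word3 t j : [\/ word t j = 0, word t j = 1 | word t j = - 1].
Proof. exact: wt3. Qed.

Variable m : nat.
Hypothesis nE : n = (2 * m)%N.

Lemma even_count : (m * #|[set t | (n%:Z %| wsum t)%Z]|)%N =
  #|[set t | (2 %| wsum t)%Z]|.
Proof.
rewrite (@wsum_rot_count 2 m (inord 1) xpredT) // wt_sum inordK; try lia.
by rewrite (_ : _ - _ = 0) ?dvdz0.
Qed.

Definition half_block x y (t : 'S_n) := (word t x == 0) != (word t y == 0).

Lemma half_block_swap x y t : (x < n)%N -> (y < n)%N -> (2 %| x + y.+1)%N ->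
  half_block x y t -> (2 %| wsum t)%Z -> ~~ (2 %| wsum (swap x y t))%Z.
Proof.
move=> hx hy hxy; rewrite /half_block wsum_swap //.
by case: (word3 t x) => ->; case: (word3 t y) => -> //= _; lia.
Qed.

Definition unpaired (x y : nat -> nat) (t : 'S_n) :=
  [exists i : 'I_m, half_block (x i) (y i) t].

Lemma pairedP (x y : nat -> nat) t :
  reflect (forall i, (i < m)%N -> (word t (x i) == 0) = (word t (y i) == 0))
          (~~ unpaired x y t).
Proof.
rewrite negb_exists; apply: (iffP forallP) => [h i im|h i].
  by have := h (Ordinal im); rewrite negbK => /eqP.
by rewrite negbK h.
Qed.

(** The pairs are disjoint, so an exchange within one of them preserves which pairs are half blocks;
    [toggle_half] applies. *)
Lemma unpaired_half (x y : nat -> nat) :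
  (forall i, (i < m)%N -> (x i < n)%N /\ (y i < n)%N) ->
  (forall i, (2 %| x i + (y i).+1)%N) ->
  (forall i j, (i < m)%N -> (j < m)%N -> i != j ->
    [/\ x i != x j, x i != y j & y i != y j]) ->
  (2 * #|[set t | unpaired x y t && (2 %| wsum t)%Z]|
     <= #|[set t | unpaired x y t]|)%N.
Proof.
move=> lt par dis.
have Qact (i j : 'I_m) t : half_block (x j) (y j) (swap (x i) (y i) t) =
    half_block (x j) (y j) t.
  have [lxi lyi] := lt i (ltn_ord i); have [lxj lyj] := lt j (ltn_ord j).
  rewrite /half_block !word_swap //.
  case: (eqVneq i j) => [->|nij].
    rewrite !eqxx; case: (eqVneq (y j) (x j)) => [->|_] //.
    by case: (word t (y j) == 0); case: (word t (x j) == 0).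
  have [] := dis j i (ltn_ord j) (ltn_ord i); first by rewrite eq_sym.
  have [] := dis i j (ltn_ord i) (ltn_ord j) nij.
  move=> _ A _ B C D.
  by rewrite [y j == x i]eq_sym (negbTE A) (negbTE B) (negbTE C) (negbTE D).
apply: (@toggle_half _ _ (fun i : 'I_m => swap (x i) (y i))
  (fun t i => half_block (x i) (y i) t)) => //.
- by move=> i t; rewrite swapK.
- by move=> i t _ Qi; apply/existsP; exists i; rewrite Qact.
- move=> i t _ Qi; have [lx ly] := lt i (ltn_ord i).
  by apply: half_block_swap.
- by move=> t /existsP.
Qed.

Lemma sum_adjacent (F : nat -> int) :
  \sum_(0 <= j < n) F j = \sum_(0 <= i < m) (F (2 * i)%N + F (2 * i).+1).
Proof.
rewrite nE; elim: m => [|p IH]; first by rewrite !big_nil.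
rewrite [RHS]big_nat_recr //= -IH mulnS addnC !addnS addn0 !big_nat_recr //=.
by rewrite addrA.
Qed.

Lemma sum_antipodal (F : nat -> int) :
  \sum_(0 <= j < n) F j = \sum_(0 <= i < m) (F i + F (i + m)%N).
Proof. by rewrite nE sum_halves. Qed.

Local Notation adjacent_unpaired :=
  (unpaired (fun i => 2 * i)%N (fun i => (2 * i).+1)).
Local Notation antipodal_unpaired := (unpaired id (fun i => i + m)%N).

Lemma unpaired_adjacent_half :
  (2 * #|[set t | adjacent_unpaired t && (2 %| wsum t)%Z]|
     <= #|[set t | adjacent_unpaired t]|)%N.
Proof.
apply: unpaired_half => [i im|i|i j im jm nij]; try split; lia.
Qed.

(** A block [{2i, 2i+1}] with two nonzero weights contributes 2 to the sum of squares and an odd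
    number to D; the other blocks contribute 0. So [e] counts the former blocks. *)
Lemma paired_adjacent_parity t :
  ~~ adjacent_unpaired t ->
  exists2 e, \sum_i wt i ^+ 2 = 2 * e & (2 %| wsum t - e)%Z.
Proof.
move=> /pairedP P; exists (\sum_(0 <= i < m) word t (2 * i)%N ^+ 2).
  rewrite (reindex_inj (@perm_inj _ t)) /=.
  have -> : \sum_v wt (t v) ^+ 2 = \sum_(0 <= j < n) word t j ^+ 2.
    by rewrite big_mkord; apply: eq_bigr => v _; rewrite /word inord_val.
  rewrite sum_adjacent big_distrr /= !big_mkord; apply: eq_bigr => i _.
  have := P i (ltn_ord i).
  by case: (word3 t (2 * i)%N) => ->; case: (word3 t (2 * i).+1) => ->.
rewrite wsum_word sum_adjacent -sumrB !big_mkord; apply: rpred_sum => i _.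
have := P i (ltn_ord i).
by case: (word3 t (2 * i)%N) => ->; case: (word3 t (2 * i).+1) => -> //= _; lia.
Qed.

Lemma card_zero_le : (#|[set t | wsum t == 0]| <= #|[set t | (n%:Z %| wsum t)%Z]|)%N.
Proof.
by apply: subset_leq_card; apply/subsetP => t; rewrite !inE => /eqP ->; rewrite dvdz0.
Qed.

(** With [e] odd, paired words have D odd, so only unpaired words, of which at most half have D
    even, can have n | D. The paired [t0] makes the bound strict. *)
Lemma zero_bound_odd_pairs (e : int) t0 :
  \sum_i wt i ^+ 2 = 2 * e -> ~~ (2 %| e)%Z ->
  ~~ adjacent_unpaired t0 ->
  (2 * m * #|[set t | wsum t == 0]| < #|{: 'S_n}|)%N.
Proof.
move=> eE e2; set X := unpaired _ _ => Xt0.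
have XH := unpaired_adjacent_half; rewrite -/X in XH.
have := card_split (fun t => 2 %| wsum t)%Z X.
rewrite [X in (_ + X)%N](_ : _ = 0%N); last first.
  apply: eq_card0 => t; rewrite !inE; apply/negP => /andP[Yt Dt].
  have [e' E' D'] := paired_adjacent_parity Yt; lia.
have := even_count; have := leq_mul (leqnn m) card_zero_le.
have : (#|[set t | X t]| + #|~: [set t | X t]|)%N = #|{: 'S_n}| by rewrite cardsC.
have : (0 < #|~: [set t | X t]|)%N by apply/card_gt0P; exists t0; rewrite !inE.
lia.
Qed.

(** * Odd m: the pairs [{i, i + m}] *)

Lemma unpaired_antipodal_rot t :
  antipodal_unpaired (rot_perm (inord 1) * t)%g =
  antipodal_unpaired t.
Proof.
have wr j : (j.+1 < n)%N -> word (rot_perm (inord 1) * t)%g j = word t j.+1.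
  by move=> hj; rewrite word_rot ?inordK ?add1n ?modn_small //; lia.
have wrn j : j.+1 = n -> word (rot_perm (inord 1) * t)%g j = word t 0%N.
  by move=> hj; rewrite word_rot ?inordK ?add1n ?hj ?modnn //; lia.
have m0 : (0 < m)%N by lia.
apply/idP/idP; apply: contraTT => /pairedP P; apply/pairedP => i im.
  (* The last pair [{m-1, 2m-1}] rotates to [{m, 0}], the first pair in reverse order. *)
  case: (eqVneq i.+1 m) => im'.
    have := P 0%N m0; rewrite add0n => E.
    by rewrite wr ?wrn ?im' ?E //; lia.
  have im1 : (i.+1 < m)%N by lia.
  by have := P _ im1; rewrite addSn !wr //; lia.
case: i im => [_|i im].
  have pm : (m.-1 < m)%N by lia.
  have w1 : word (rot_perm (inord 1) * t)%g m.-1 = word t m.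
    by rewrite wr ?prednK //; lia.
  have w2 : word (rot_perm (inord 1) * t)%g (m.-1 + m) = word t 0%N.
    by rewrite wrn //; lia.
  by have := P _ pm; rewrite w1 w2 => ->.
have im1 : (i < m)%N by lia.
by have := P _ im1; rewrite addSn !wr //; lia.
Qed.

Lemma zero_bound_antipodal t0 : odd m ->
  ~~ antipodal_unpaired t0 -> (n%:Z %| wsum t0)%Z ->
  2 * n%:Z <= wsum t0 ->
  (2 * m * #|[set t | wsum t == 0]| < #|{: 'S_n}|)%N.
Proof.
move=> m_odd; set X := unpaired _ _ => Yt0 nD0 D0.
have XH : (2 * #|[set t | X t && (2 %| wsum t)%Z]| <= #|[set t | X t]|)%N.
  by apply: unpaired_half => [i im|i|i j im jm nij]; try split; lia.
(* The two values of D allowed by [G] are at least 2n apart, so a change by n or -n always leaves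
   [G]. Including D(t0) besides 0 yields the strict inequality. *)
pose G (t : 'S_n) := (wsum t == 0) || (wsum t == wsum t0).
have YH : (2 * #|[set t | (~~ X t && (n%:Z %| wsum t)%Z) && G t]| <=
    #|[set t | ~~ X t && (n%:Z %| wsum t)%Z]|)%N.
  have wordE (i j : 'I_m) t :
     word (swap i (i + m) t) j = word t (if j == i then i + m else j)%N /\
     word (swap i (i + m) t) (j + m)%N = word t (if j == i then i : nat else j + m)%N.
    have im := ltn_ord i; have jm := ltn_ord j.
    rewrite !word_swap; try lia.
    case: (eqVneq j i) => [->|/eqP ne]; first by split; repeat case: eqP => //; lia.
    have {}ne : (j : nat) <> i by move/val_inj.
    by split; repeat case: eqP => //; lia.
  have change (i : 'I_m) t : ~~ X t && (n%:Z %| wsum t)%Z ->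
      word t i != word t (i + m)%N ->
      wsum (swap i (i + m) t) = wsum t + n%:Z \/
      wsum (swap i (i + m) t) = wsum t - n%:Z.
    move=> /andP[/pairedP P _]; have im := ltn_ord i; have := P i im.
    rewrite wsum_swap; try lia.
    by case: (word3 t i) => ->; case: (word3 t (i + m)%N) => -> //= _ _; lia.
  apply: (@toggle_half _ _ (fun (i : 'I_m) => swap i (i + m))
    (fun t i => word t i != word t (i + m)%N)) => [i t|i j t|i t Rt Qi|i t Rt Qi|t Rt].
  - exact: swapK.
  - have [-> ->] := wordE i j t.
    by case: (eqVneq j i) => [->|] //; rewrite eq_sym.
  - have nD' : (n%:Z %| wsum (swap i (i + m) t))%Z.
      by have := andP Rt => -[_ nD]; case: (change i t Rt Qi) => ->; rewrite ?rpredB ?rpredD.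
    rewrite nD' andbT; apply/pairedP => j jm; have /andP[/pairedP P _] := Rt.
    have /= [-> ->] := wordE i (Ordinal jm) t.
    by case: (eqVneq _ i) => [<-|_] /=; rewrite (P j jm).
  - rewrite /G => /orP[] /eqP E; case: (change i t Rt Qi) => ->; rewrite E; lia.
  (* Otherwise the word has period m, its first half sums to 1, and D has the parity of m, which is
     odd, although n | D. *)
  - case: (boolP [exists i : 'I_m, word t i != word t (i + m)%N]) => [/existsP //|].
    rewrite negb_exists => /forallP h _; exfalso.
    have {}h i : (i < m)%N -> word t (i + m)%N = word t i.
      by move=> im; have := h (Ordinal im); rewrite negbK => /eqP.
    have S : \sum_(0 <= i < m) word t i = 1.
      have := sum_word t; rewrite wt_sum sum_antipodal.
      rewrite (eq_big_nat _ _ (F2 := fun i => 2 * word t i)).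
        rewrite -big_distrr /=.
        by move: (\sum_(_ <= i < _) _) => z; lia.
      by move=> i im; rewrite h ?mulrDl ?mul1r //; lia.
    have : (2 %| wsum t - m%:Z * \sum_(0 <= i < m) word t i)%Z.
      rewrite wsum_word sum_antipodal big_distrr /= -sumrB big_mkord.
      apply: rpred_sum => i _; rewrite h //.
      rewrite !PoszD (_ : _ - _ = 2 * (word t i * (i%:Z + k%:Z))).
        exact: dvdz_mulr.
      by ring.
    have /andP[_ /dvdzP[z ->]] := Rt; rewrite S nE; lia.
have YG : (#|[set t | ~~ X t && (wsum t == 0)]| <
    #|[set t | (~~ X t && (n%:Z %| wsum t)%Z) && G t]|)%N.
  apply: proper_card; apply/properP; split.
    apply/subsetP => t; rewrite !inE => /andP[-> /eqP E].
    by rewrite /G E dvdz0 eqxx.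
  exists t0; first by rewrite !inE Yt0 nD0 /G eqxx orbT.
  by rewrite !inE Yt0 /=; lia.
have XZ : (#|[set t | X t && (wsum t == 0)]| <=
    #|[set t | X t && (n%:Z %| wsum t)%Z]|)%N.
  apply: subset_leq_card; apply/subsetP => t; rewrite !inE => /andP[-> /eqP ->].
  by rewrite dvdz0.
have Yrot : (m * #|[set t | ~~ X t && (n%:Z %| wsum t)%Z]|)%N =
    #|[set t | ~~ X t && (2 %| wsum t)%Z]|.
  apply: (@wsum_rot_count 2 m (inord 1)) => //; last first.
    by move=> t; rewrite /X unpaired_antipodal_rot.
  rewrite wt_sum inordK; last by lia.
  by rewrite (_ : _ - _ = 0) ?dvdz0.
have Ye : (#|[set t | ~~ X t && (2 %| wsum t)%Z]| <= #|~: [set t | X t]|)%N.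
  by apply: subset_leq_card; apply/subsetP => t; rewrite !inE => /andP[].
have m0 : (0 < m)%N by lia.
exact: (antipodal_arith m0 XH YH YG XZ Yrot even_count Ye (cardsC _)
  (card_split _ X) (card_split _ X) (card_split _ X)).
Qed.

(** * The pairs [{2i, 2i+1}]: rotation by 2 and D modulo 4 *)

Lemma unpaired_adjacent_rot t : (1 < m)%N ->
  adjacent_unpaired (rot_perm (inord 2) * t)%g = adjacent_unpaired t.
Proof.
move=> m1.
have wr j : (j.+2 < n)%N -> word (rot_perm (inord 2) * t)%g j = word t j.+2.
  by move=> hj; rewrite word_rot ?inordK ?add2n ?modn_small //; lia.
have wrn j : (n <= j.+2 < n + n)%N -> (j < n)%N ->
    word (rot_perm (inord 2) * t)%g j = word t (j.+2 - n)%N.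
  move=> h hj; rewrite word_rot ?inordK ?add2n //; try lia.
  by rewrite -[in LHS](@subnK n j.+2) ?modnDr ?modn_small //; lia.
have w1 : word (rot_perm (inord 2) * t)%g (2 * m.-1) = word t 0%N.
  by rewrite wrn; [congr word| |]; lia.
have w2 : word (rot_perm (inord 2) * t)%g (2 * m.-1).+1 = word t 1%N.
  by rewrite wrn; [congr word| |]; lia.
apply/idP/idP; apply: contraTT => /pairedP P; apply/pairedP => i im.
  case: (eqVneq i.+1 m) => im'.
    have -> : i = m.-1 by lia.
    by rewrite w1 w2; have := P 0%N; rewrite muln0 => -> //; lia.
  have im1 : (i.+1 < m)%N by lia.
  by have := P _ im1; rewrite mulnS add2n !wr //; lia.
case: i im => [_|i im].
  have pm : (m.-1 < m)%N by lia.
  by have := P _ pm; rewrite w1 w2 muln0.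
have im1 : (i < m)%N by lia.
by have := P _ im1; rewrite mulnS add2n !wr //; lia.
Qed.

(** Otherwise block [i] contributes w(2i) (4i + 1 + 2k) and the w(2i) sum to 1, so D is odd. *)
Lemma paired_mixed_block t : ~~ adjacent_unpaired t -> (2 %| wsum t)%Z ->
  exists i : 'I_m, word t (2 * i)%N != word t (2 * i).+1.
Proof.
move=> Yt D2.
case: (boolP [exists i : 'I_m, word t (2 * i)%N != word t (2 * i).+1])
  => [/existsP //|].
rewrite negb_exists => /forallP h; exfalso.
have {}h i : (i < m)%N -> word t (2 * i).+1 = word t (2 * i)%N.
  by move=> im; have := h (Ordinal im); rewrite negbK => /eqP.
have S : \sum_(0 <= i < m) word t (2 * i)%N = 1.
  have := sum_word t; rewrite wt_sum sum_adjacent.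
  rewrite (eq_big_nat _ _ (F2 := fun i => 2 * word t (2 * i)%N)).
    rewrite -big_distrr /=.
    by move: (\sum_(_ <= i < _) _) => z; lia.
  by move=> i im; rewrite h ?mulrDl ?mul1r //; lia.
have : (2 %| wsum t - \sum_(0 <= i < m) word t (2 * i)%N)%Z.
  rewrite wsum_word sum_adjacent -sumrB big_mkord.
  apply: rpred_sum => i _; rewrite h // addSn -addn1.
  rewrite !PoszD (_ : _ - _ = 2 * (word t (2 * i)%N * ((2 * i)%N%:Z + k%:Z))).
    exact: dvdz_mulr.
  by ring.
rewrite S; lia.
Qed.

(** Exchanging within a block of weights 1 and -1 changes D by 2 or -2. The words with 4 not
    dividing D are the ones bounded above, because those with 4 | D must be numerous enough. *)
Lemma paired_mod4_half :
  (2 * #|[set t | (~~ adjacent_unpaired t && (2 %| wsum t)%Z) && ~~ (4 %| wsum t)%Z]|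
    <= #|[set t | ~~ adjacent_unpaired t && (2 %| wsum t)%Z]|)%N.
Proof.
have wordE (i j : 'I_m) t :
   word (swap (2 * i) (2 * i).+1 t) (2 * j)%N =
     word t (if j == i then (2 * i).+1 else 2 * j)%N /\
   word (swap (2 * i) (2 * i).+1 t) (2 * j).+1 =
     word t (if j == i then (2 * i)%N else (2 * j).+1).
  have im := ltn_ord i; have jm := ltn_ord j.
  rewrite !word_swap; try lia.
  case: (eqVneq j i) => [->|/eqP ne]; first by split; repeat case: eqP => //; lia.
  have {}ne : (j : nat) <> i by move/val_inj.
  by split; repeat case: eqP => //; lia.
have change (i : 'I_m) t : ~~ adjacent_unpaired t && (2 %| wsum t)%Z ->
    word t (2 * i)%N != word t (2 * i).+1 ->
    wsum (swap (2 * i) (2 * i).+1 t) = wsum t + 2 \/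
    wsum (swap (2 * i) (2 * i).+1 t) = wsum t - 2.
  move=> /andP[/pairedP P _]; have im := ltn_ord i; have := P i im.
  rewrite wsum_swap; try lia.
  by case: (word3 t (2 * i)%N) => ->; case: (word3 t (2 * i).+1) => -> //= _ _; lia.
apply: (@toggle_half _ _ (fun (i : 'I_m) => swap (2 * i) (2 * i).+1)
  (fun t i => word t (2 * i)%N != word t (2 * i).+1))
  => [i t|i j t|i t Rt Qi|i t Rt Qi|t /andP[Yt D2] _].
- exact: swapK.
- have [-> ->] := wordE i j t.
  by case: (eqVneq j i) => [->|] //; rewrite eq_sym.
- have -> : (2 %| wsum (swap (2 * i) (2 * i).+1 t))%Z.
    by have /andP[_] := Rt; case: (change i t Rt Qi) => ->; lia.
  rewrite andbT; apply/pairedP => j jm; have /andP[/pairedP P _] := Rt.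
  have /= [-> ->] := wordE i (Ordinal jm) t.
  by case: (eqVneq _ i) => [<-|_] /=; rewrite (P j jm).
- have /andP[_] := Rt; case: (change i t Rt Qi) => ->; lia.
- exact: paired_mixed_block.
Qed.

(** * Even m: exchanging the blocks [{2i, 2i+1}] and [{2i+m, 2i+1+m}] *)

Definition block_swap (i : nat) (t : 'S_n) :=
  swap (2 * i) (2 * i + m) (swap (2 * i).+1 ((2 * i).+1 + m) t).

(** The action of [block_swap] on values when m = 2q: [j %/ 2] is the block of [j], and block [i] is
    matched with block [i + q]. *)
Definition block_image (q i j : nat) : nat :=
  (if j %/ 2 == i then j + m else if j %/ 2 == i + q then j - m else j)%N.

Lemma word_block_swap q i t j : m = (2 * q)%N -> (i < q)%N -> (j < n)%N ->
  word (block_swap i t) j = word t (block_image q i j).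
Proof.
move=> mE iq jn; rewrite word_swap; try lia.
rewrite /block_image word_swap; try (by repeat case: eqP; lia).
by congr word; repeat case: eqP => //; lia.
Qed.

Lemma wsum_block_swap q i t : m = (2 * q)%N -> (i < q)%N ->
  wsum (block_swap i t) = wsum t + m%:Z *
    ((word t (2 * i)%N + word t (2 * i).+1)
      - (word t (2 * i + m)%N + word t ((2 * i).+1 + m)%N)).
Proof.
move=> mE iq; rewrite /block_swap !wsum_swap ?word_swap; try lia.
by rewrite !ifF; apply/eqP; lia.
Qed.

Lemma block_swapK q i t : m = (2 * q)%N -> (i < q)%N ->
  block_swap i (block_swap i t) = t.
Proof.
move=> mE iq; rewrite /block_swap.
suff C u : swap (2 * i).+1 ((2 * i).+1 + m) (swap (2 * i) (2 * i + m) u) =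
    swap (2 * i) (2 * i + m) (swap (2 * i).+1 ((2 * i).+1 + m) u).
  by rewrite C !swapK.
have ne x y : (x < n)%N -> (y < n)%N -> x != y -> (inord x : 'I_n) != inord y.
  by move=> hx hy; rewrite -val_eqE /= !inordK.
rewrite /swap !mulgA; congr (_ * _)%g.
by rewrite [LHS]conjgC tpermJ !tpermD //; apply: ne; lia.
Qed.

(** Block totals of a paired word are even, so exchanging matched blocks of different totals changes
    D by a nonzero multiple of 2m = n. *)
Lemma block_zero_half q : m = (2 * q)%N ->
  (2 * #|[set t | (~~ adjacent_unpaired t && (n%:Z %| wsum t)%Z) && (wsum t == 0)]|
    <= #|[set t | ~~ adjacent_unpaired t && (n%:Z %| wsum t)%Z]|)%N.
Proof.
move=> mE.
pose bsum (t : 'S_n) i : int := word t (2 * i)%N + word t (2 * i).+1.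
have bsumE t i : (i < m)%N -> ~~ adjacent_unpaired t -> (2 %| bsum t i)%Z.
  move=> im /pairedP P; have := P i im; rewrite /bsum.
  by case: (word3 t (2 * i)%N) => ->; case: (word3 t (2 * i).+1) => ->.
(* The action of the exchange on block indices. *)
pose bl (i j : nat) := (if j == i then j + q else if j == i + q then j - q else j)%N.
have wordE (i : 'I_q) (j : nat) t : (j < m)%N ->
   word (block_swap i t) (2 * j)%N = word t (2 * bl i j)%N /\
   word (block_swap i t) (2 * j).+1 = word t (2 * bl i j).+1.
  move=> jm; have iq := ltn_ord i.
  rewrite !(word_block_swap t mE iq); try lia.
  by split; congr word; rewrite /block_image /bl; repeat case: eqP => //; lia.
have blt (i : 'I_q) j : (j < m)%N -> (bl i j < m)%N.
  by move=> jm; have iq := ltn_ord i; rewrite /bl; repeat case: eqP => //; lia.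
have change (i : 'I_q) t : wsum (block_swap i t) =
    wsum t + m%:Z * (bsum t i - bsum t (i + q)%N).
  by rewrite (wsum_block_swap t mE (ltn_ord i)) /bsum mulnDr -mE.
apply: (@toggle_half _ _ (fun i : 'I_q => block_swap i)
  (fun t i => bsum t i != bsum t (i + q)%N))
  => [i t|i j t|i t /andP[Yt nD] Qi|i t /andP[Yt nD] Qi /eqP D0|t /andP[Yt nD] _].
- exact: block_swapK (ltn_ord i).
- have iq := ltn_ord i; have jq := ltn_ord j; rewrite /bsum.
  have [|-> ->] := wordE i j t; first lia.
  have [|-> ->] := wordE i (j + q)%N t; first lia.
  case: (eqVneq j i) => [->|/eqP ne].
    have -> : bl i i = (i + q)%N by rewrite /bl eqxx.
    have -> : bl i (i + q)%N = i by rewrite /bl ifF ?eqxx ?addnK //; lia.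
    by rewrite eq_sym.
  have {}ne : (j : nat) <> i by move/val_inj.
  have -> : bl i j = j by rewrite /bl !ifF //; lia.
  by have -> : bl i (j + q)%N = (j + q)%N by rewrite /bl !ifF //; lia.
- have iq := ltn_ord i; apply/andP; split.
    apply/pairedP => j jm; have [-> ->] := wordE i j t jm.
    by have /pairedP P := Yt; apply: P; apply: blt.
  rewrite change rpredD //; have /dvdzP[z1 E1] := bsumE t i ltac:(lia) Yt.
  have /dvdzP[z2 E2] := bsumE t (i + q)%N ltac:(lia) Yt.
  rewrite E1 E2 nE -mulrBl mulrA [X in (_ %| X)%Z]mulrC PoszM mulrA.
  exact: dvdz_mulr.
- rewrite change D0 add0r mulf_eq0 negb_or subr_eq0 Qi andbT; lia.
(* If matched totals, all even, were always equal, the total weight would be divisible by 4, but it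
   is 2. *)
- case: (boolP [exists i : 'I_q, bsum t i != bsum t (i + q)%N]) => [/existsP //|].
  rewrite negb_exists => /forallP h; exfalso.
  have {}h i : (i < q)%N -> bsum t (i + q)%N = bsum t i.
    by move=> iq; have := h (Ordinal iq); rewrite negbK => /eqP.
  have : \sum_(0 <= i < 2 * q) bsum t i = 2 by rewrite -mE -sum_adjacent sum_word.
  rewrite sum_halves => E.
  have : (4 %| \sum_(0 <= i < q) (bsum t i + bsum t (i + q)%N))%Z.
    rewrite big_mkord; apply: rpred_sum => i _; rewrite h //.
    have im : (i < m)%N by have := ltn_ord i; lia.
    by have /dvdzP[z ->] := bsumE t i im Yt; rewrite -mulrDr dvdz_mull.
  by rewrite E.
Qed.

(** Here strictness comes from the unpaired words, through [t0]. *)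
Lemma zero_bound_adjacent q t0 : m = (2 * q)%N ->
  adjacent_unpaired t0 -> (n%:Z %| wsum t0)%Z -> wsum t0 != 0 ->
  (2 * m * #|[set t | wsum t == 0]| < #|{: 'S_n}|)%N.
Proof.
move=> mE; have XH := unpaired_adjacent_half.
have Y4 := paired_mod4_half; have YH := block_zero_half mE.
move: XH Y4 YH; set X := unpaired _ _ => XH Y4 YH Xt0 nD0 D0.
have q0 : (0 < q)%N by lia.
have XZ : (#|[set t | X t && (wsum t == 0)]| <
    #|[set t | X t && (n%:Z %| wsum t)%Z]|)%N.
  apply: proper_card; apply/properP; split.
    by apply/subsetP => t; rewrite !inE => /andP[-> /eqP ->]; rewrite dvdz0.
  by exists t0; rewrite !inE ?Xt0 ?nD0 // negb_and D0 orbT.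
have Yrot : (q * #|[set t | ~~ X t && (n%:Z %| wsum t)%Z]|)%N =
    #|[set t | ~~ X t && (4 %| wsum t)%Z]|.
  apply: (@wsum_rot_count 4 q (inord 2)) => //; first by lia.
    rewrite wt_sum inordK; last by lia.
    by rewrite (_ : _ - _ = 0) ?dvdz0.
  by move=> t; rewrite /X unpaired_adjacent_rot //; lia.
have Ye : (#|[set t | ~~ X t && (2 %| wsum t)%Z]| <= #|~: [set t | X t]|)%N.
  by apply: subset_leq_card; apply/subsetP => t; rewrite !inE => /andP[].
have YH' : (2 * #|[set t | ~~ X t && (wsum t == 0)]| <=
    #|[set t | ~~ X t && (n%:Z %| wsum t)%Z]|)%N.
  apply: leq_trans YH; rewrite leq_mul2l /= subset_leq_card //.
  apply/subsetP => t; rewrite !inE => /andP[-> /eqP ->].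
  by rewrite dvdz0 eqxx.
have S4 : #|[set t | ~~ X t && (2 %| wsum t)%Z]| =
    (#|[set t | ~~ X t && (4 %| wsum t)%Z]| +
     #|[set t | (~~ X t && (2 %| wsum t)%Z) && ~~ (4 %| wsum t)%Z]|)%N.
  rewrite (card_split _ (fun t => 4 %| wsum t)%Z); congr (_ + _)%N.
    by apply: eq_card => t; rewrite !inE; case: (X t) => //=; lia.
  by apply: eq_card => t; rewrite !inE andbC.
exact: (adjacent_arith q0 mE XH Y4 YH' XZ Yrot even_count Ye (cardsC _)
  (card_split _ X) (card_split _ X) (card_split _ X) S4).
Qed.

End WeightedPermutations.

(** * The weights of D, and words with prescribed values *)

Definition ab_weight n (a b : nat) (i : 'I_n) : int :=
  ((i < a)%N : nat)%:Z - ((a <= i < a + b)%N : nat)%:Z.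

Lemma ab_weight3 n a b (i : 'I_n) :
  [\/ ab_weight a b i = 0, ab_weight a b i = 1 | ab_weight a b i = - 1].
Proof.
rewrite /ab_weight; case: ltnP => ai /=; first by constructor 2; lia.
by case: ltnP => ab /=; [constructor 3|constructor 1].
Qed.

Lemma sum_prefix n' a (F : nat -> int) : (a <= n'.+1)%N ->
  \sum_(i < n'.+1) ((i < a)%N : nat)%:Z * F i = \sum_(0 <= i < a) F i.
Proof.
move=> an; rewrite -(big_mkord xpredT (fun i => ((i < a)%N : nat)%:Z * F i)).
rewrite (big_cat_nat (leq0n a) an) /= [X in _ + X]big1_seq ?addr0.
  rewrite !big_nat; apply: eq_bigr => i /andP[_ ->]; exact: mul1r.
by move=> i /andP[_]; rewrite mem_index_iota => /andP[ai _]; rewrite ltnNge ai mul0r.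
Qed.

Lemma sum_ab_weight n' a b (F : nat -> int) : (a + b <= n'.+1)%N ->
  \sum_(i < n'.+1) ab_weight a b i * F i =
  \sum_(0 <= i < a) F i - \sum_(a <= i < a + b) F i.
Proof.
move=> abn.
(* The weight is twice the indicator of [i < a] minus that of [i < a + b], two prefixes. *)
rewrite (eq_bigr (fun i : 'I_n'.+1 => 2 * (((i < a)%N : nat)%:Z * F i)
   - ((i < a + b)%N : nat)%:Z * F i)).
  rewrite big_split /= -big_distrr /= sumrN !sum_prefix; try lia.
  rewrite [X in _ - X](big_cat_nat (leq0n a) (leq_addr b a)) /=.
  by ring.
move=> i _; rewrite /ab_weight.
case: (ltnP i a) => ia /=; last by rewrite mul0r; case: ltnP => _ /=; ring.
by rewrite ltn_addr //=; ring.
Qed.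

Lemma sum_shift k (l : seq nat) :
  \sum_(x <- l) (x + k)%N%:Z = (sumn l + size l * k)%N%:Z.
Proof.
elim: l => [|x l IH]; first by rewrite big_nil.
by rewrite big_cons IH /=; lia.
Qed.

(** Any disjoint duplicate-free lists can be the values of weight 1 and -1, so a witness word may be
    given by two lists. *)
Lemma exists_perm_of_values n' k (la lb : seq nat) :
  uniq (la ++ lb) -> all (fun x => x < n'.+1)%N (la ++ lb) ->
  exists t : 'S_n'.+1,
    wsum k (ab_weight (size la) (size lb)) t =
      (sumn la + size la * k)%N%:Z - (sumn lb + size lb * k)%N%:Z /\
    forall x, (x < n'.+1)%N ->
      (word (ab_weight (size la) (size lb)) t x == 0) = (x \notin la ++ lb).
Proof.
set l := la ++ lb => ul ltl.
pose l1 : seq 'I_n'.+1 := [seq inord x | x <- l].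
have valK : [seq val v | v <- l1] = l.
  rewrite -map_comp map_id_in // => x xl /=.
  by rewrite inordK //; have /allP := ltl; apply.
have ul1 : uniq l1 by rewrite -(map_inj_uniq val_inj) valK.
(* All values in the order of their positions: [la], [lb], then the rest. The word is the inverse of
   this enumeration. *)
pose L := l1 ++ [seq v <- enum 'I_n'.+1 | v \notin l1].
have uL : uniq L.
  rewrite cat_uniq ul1 filter_uniq ?enum_uniq // andbT.
  by apply/hasPn => v; rewrite mem_filter => /andP[].
have sL : size L = n'.+1.
  rewrite -[RHS](size_enum_ord n'.+1); apply: perm_size.
  apply: uniq_perm => //; first exact: enum_uniq.
  by move=> v; rewrite mem_cat mem_filter mem_enum inE andbT orbN.
have sl : size l1 = (size la + size lb)%N by rewrite size_map size_cat.
have slL : (size l1 <= n'.+1)%N by have := sL; rewrite size_cat; lia.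
have finj : injective (fun i : 'I_n'.+1 => nth ord0 L i).
  move=> i j /eqP; rewrite nth_uniq ?sL // => /eqP; exact: val_inj.
pose s := perm finj.
have sE (i : 'I_n'.+1) : (i < size l1)%N -> val (s i) = nth 0%N l i.
  move=> il; rewrite permE /L nth_cat il -valK (nth_map ord0) //.
exists (s^-1)%g; split.
  rewrite /wsum (reindex_inj (@perm_inj _ s)) /=.
  rewrite (eq_bigr (fun i : 'I_n'.+1 =>
     ab_weight (size la) (size lb) i * (nth 0 l i + k)%N%:Z)); last first.
    move=> i _; rewrite permK; case: (ltnP i (size l1)) => il.
      by rewrite sE.
    rewrite /ab_weight -sl [(i < size l1)%N]ltnNge il andbF.
    by rewrite ltnNge (leq_trans _ il) ?mul0r // sl leq_addr.
  rewrite (sum_ab_weight (fun i => (nth 0 l i + k)%N%:Z)) -?sl // -!sum_shift; congr (_ - _).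
    rewrite [RHS](big_nth 0%N) !big_nat; apply: eq_bigr => i /andP[_ ia].
    by rewrite nth_cat ia.
  rewrite [RHS](big_nth 0%N) -{1}[size la]add0n big_addn sl addKn.
  by apply: eq_bigr => i _; rewrite nth_cat ltnNge leq_addl /= addnK.
move=> x xn; rewrite /word.
have wE (i : 'I_n'.+1) : (ab_weight (size la) (size lb) i == 0) = (size l1 <= i)%N.
  by rewrite sl /ab_weight; lia.
rewrite wE leqNgt; congr (~~ _); apply/idP/idP => [|xl].
  move=> h; have := sE _ h; rewrite permKV /= inordK // => ->.
  by rewrite mem_nth // size_cat -sl.
have il : (index x l < size l)%N by rewrite index_mem.
have il' : (index x l < n'.+1)%N by rewrite (leq_trans il) // size_cat -sl.
have h : val (s (Ordinal il')) = x.
  by rewrite sE /= ?nth_index // sl -size_cat.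
have -> : inord x = s (Ordinal il') by apply: val_inj; rewrite h /= inordK.
by rewrite permK /= sl -size_cat.
Qed.

(* [b] pairs of consecutive values, the larger one in [la], avoiding [v]; the
   shift by the parity of [v] keeps [v] from separating a pair. *)
Lemma exists_paired_values (N v b : nat) : (2 * b + 2 <= N)%N -> (v < N)%N ->
  exists la lb, [/\ size la = b.+1, size lb = b, uniq (la ++ lb),
    all (fun x => x < N)%N (la ++ lb) & sumn la = (sumn lb + v + b)%N].
Proof.
move=> bN vN; pose o : nat := odd v.
pose f i := (2 * i + o).+1; pose g i := (2 * i + o)%N.
exists (v :: [seq bump v (f i) | i <- iota 0 b]).
exists [seq bump v (g i) | i <- iota 0 b]; split.
- by rewrite /= size_map size_iota.
- by rewrite size_map size_iota.
- rewrite cat_cons (map_comp (bump v) f) (map_comp (bump v) g) -map_cat /=.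
  apply/andP; split.
    by apply/mapP => -[x _ E]; have := neq_bump v x; rewrite -E eqxx.
  rewrite (map_inj_uniq (can_inj (bumpK v))) cat_uniq !map_inj_uniq ?iota_uniq.
  + rewrite andbT /=; apply/hasPn => _ /mapP[i _ ->]; apply/mapP => -[j _].
    by rewrite /f /g; lia.
  + by move=> i j; rewrite /g; lia.
  + by move=> i j; rewrite /f; lia.
- rewrite /= vN /= all_cat; apply/andP; split; apply/allP => _ /mapP[i + ->];
    rewrite mem_iota /bump /f /g /o; lia.
- have E s : sumn [seq bump v (f i) | i <- s] =
      (sumn [seq bump v (g i) | i <- s] + size s)%N.
    elim: s => //= i s ->; suff -> : bump v (f i) = (bump v (g i)).+1 by lia.
    rewrite /bump /f /g /o; lia.
  by rewrite /= E size_iota; lia.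
Qed.

Lemma exists_avoiding_values (m b x x' : nat) : (b + 2 <= m)%N ->
  exists l, [/\ size l = b, uniq l, all (fun y => y < m)%N l, x \notin l & x' \notin l].
Proof.
move=> bm; pose F := [seq y <- iota 0 m | y \notin [:: x; x']].
have sF : (b <= size F)%N.
  have : (count (mem [:: x; x']) (iota 0 m) <= 2)%N.
    rewrite -size_filter; apply: (@uniq_leq_size _ _ [:: x; x']).
      by rewrite filter_uniq ?iota_uniq.
    by move=> y; rewrite mem_filter => /andP[].
  have := count_predC (mem [:: x; x']) (iota 0 m); rewrite size_iota.
  have -> : size F = count (predC (mem [:: x; x'])) (iota 0 m) by rewrite size_filter.
  by lia.
have sub y : y \in take b F -> y \in F by apply: mem_take.
exists (take b F); split.
- exact: size_takel.
- by rewrite take_uniq // filter_uniq ?iota_uniq.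
- by apply/allP => y /sub; rewrite mem_filter mem_iota => /andP[_]; lia.
- by apply/negP => /sub; rewrite mem_filter !inE eqxx.
- by apply/negP => /sub; rewrite mem_filter !inE eqxx orbT.
Qed.

Lemma sum_ab_weight1 n' a b : (a + b <= n'.+1)%N ->
  \sum_(i < n'.+1) ab_weight a b i = a%:Z - b%:Z.
Proof.
move=> abn; rewrite (eq_bigr (fun i : 'I_n'.+1 => ab_weight a b i * 1)).
  rewrite (sum_ab_weight (fun=> 1)) // !sumr_const_nat !subn0 addKn; lia.
by move=> i _; rewrite mulr1.
Qed.

Lemma sum_ab_weight_sqr n' a b : (a + b <= n'.+1)%N ->
  \sum_(i < n'.+1) ab_weight a b i ^+ 2 = (a + b)%N%:Z.
Proof.
move=> abn.
rewrite (eq_bigr (fun i : 'I_n'.+1 => ((i < a + b)%N : nat)%:Z * 1)).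
  by rewrite (sum_prefix (fun=> 1)) // sumr_const_nat subn0; lia.
move=> i _; rewrite mulr1 /ab_weight; case: (ltnP i a) => ia /=.
  by rewrite ltn_addr.
by case: ltnP.
Qed.

(** * The bound for a - b = 1 and for a - b = 2 *)

Lemma exists_shift_dvd n c : (0 < n)%N -> exists2 v, (v < n)%N & (n %| v + c)%N.
Proof.
move=> n0; exists ((n - c %% n) %% n)%N; first by rewrite ltn_mod.
rewrite /dvdn modnDml -modnDmr subnK ?modnn //; exact/ltnW/ltn_pmod.
Qed.

Lemma zero_bound_diff1 n' k b : (0 < k)%N -> (0 < b)%N -> ((b + 1) + b < n'.+1)%N ->
  (n'.+1 * #|[set t | wsum k (@ab_weight n'.+1 (b + 1) b) t == 0]|
     < #|{: 'S_n'.+1}|)%N.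
Proof.
move=> k0 b0 bn.
(* The witness will have D = v + b + k > 0. *)
have [v vn nv] := exists_shift_dvd (b + k) (ltn0Sn n').
have [||la [lb [sa sb ul al E]]] := @exists_paired_values n'.+1 v b; try lia.
have [t0 [D0 _]] := exists_perm_of_values k ul al.
move: D0; rewrite sa sb E -[b.+1]addn1 => D0.
have {}D0 : wsum k (ab_weight (b + 1) b) t0 = (v + (b + k))%N%:Z by rewrite D0; lia.
apply: (@zero_bound_coprime _ _ _ (inord 1) t0).
- rewrite sum_ab_weight1 ?inordK; try lia.
  by rewrite (_ : _ - _ = 0) ?dvdz0 //; lia.
- by rewrite D0.
- by rewrite D0; lia.
Qed.

Lemma zero_bound_diff2_odd n' k b :
  (0 < k)%N -> (0 < b)%N -> ((b + 2) + b < n'.+1)%N -> odd n'.+1 ->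
  (n'.+1 * #|[set t | wsum k (@ab_weight n'.+1 (b + 2) b) t == 0]|
     < #|{: 'S_n'.+1}|)%N.
Proof.
move=> k0 b0 bn n_odd.
suff [t0 nD D0] : exists2 t0 : 'S_n'.+1,
    (n'.+1%:Z %| wsum k (ab_weight (b + 2) b) t0)%Z &
    wsum k (ab_weight (b + 2) b) t0 != 0.
  (* The rotation is by (n + 1) / 2, the inverse of 2 modulo n. *)
  apply: (@zero_bound_coprime _ _ _ (inord (n'./2.+1)) t0) => //.
  rewrite sum_ab_weight1 ?inordK; try lia.
  suff -> : ((b + 2)%N%:Z - b%:Z) * n'./2.+1%:Z - 1 = n'.+1%:Z by rewrite dvdzz.
  lia.
(* With [v] and the top value [n'] besides the [b] pairs, D = v + n' + b + 2k. *)
have [v vn nv] := exists_shift_dvd (n' + b + 2 * k) (ltn0Sn n').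
case: (ltnP v n') => vn'.
  have [||la [lb [sa sb ul al E]]] := @exists_paired_values n' v b; try lia.
  have ul' : uniq ((n' :: la) ++ lb).
    by rewrite /= ul andbT; apply/negP => /(allP al); rewrite ltnn.
  have al' : all (fun x => x < n'.+1)%N ((n' :: la) ++ lb).
    by rewrite /= ltnSn; apply/allP => x /(allP al); lia.
  have [t0 [D0 _]] := exists_perm_of_values k ul' al'.
  move: D0; rewrite /= sa sb E -[b.+2]addn2 => D0.
  have {}D0 : wsum k (ab_weight (b + 2) b) t0 = (v + (n' + b + 2 * k))%N%:Z.
    by rewrite D0; lia.
  by exists t0; rewrite D0 //; lia.
(* The value [n'] cannot be used twice. The values 0 and [n' - 1] have the same sum as two copies of
   it modulo n = n' + 1; everything but 0 is obtained by a shift by 1, whence [n' - 2]. *)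
have vE : v = n' by lia.
have [||la [lb [sa sb ul al E]]] := @exists_paired_values n' (n' - 2) b; try lia.
pose la' := 0%N :: map S la; pose lb' := map S lb.
have mE : la' ++ lb' = 0%N :: map S (la ++ lb) by rewrite map_cat.
have ul' : uniq (la' ++ lb').
  rewrite mE /= (map_inj_uniq succn_inj) ul andbT; by apply/mapP => -[].
have al' : all (fun x => x < n'.+1)%N (la' ++ lb').
  by rewrite mE /= all_map; apply/allP => x /(allP al).
have sumS s : sumn (map S s) = (sumn s + size s)%N.
  by elim: s => //= x s ->; lia.
have [t0 [D0 _]] := exists_perm_of_values k ul' al'.
move: D0; rewrite /= !size_map !sumS sa sb E -[b.+2]addn2 => D0.
have {}D0 : wsum k (ab_weight (b + 2) b) t0 = (n' + b + 2 * k - 1)%N%:Z.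
  by rewrite D0; lia.
exists t0; rewrite D0; last by lia.
have -> : (n' + b + 2 * k - 1)%N%:Z = (v + (n' + b + 2 * k))%N%:Z - n'.+1%:Z by lia.
by rewrite rpredB // dvdzz.
Qed.

(** Weight 1 goes to [x], [x + m] and each [y + m], weight -1 to each [y], for [b] values [y < m].
    Then D = 2 (x + k) + (b + 1) m, and as m | x + k and b is odd, both terms are positive multiples
    of n. *)
Lemma exists_antipodal_perm n' m k b : n'.+1 = (2 * m)%N -> (0 < k)%N ->
  (b + 2 <= m)%N -> odd b ->
  exists t : 'S_n'.+1, let w := ab_weight (b + 2) b in
    [/\ (n'.+1%:Z %| wsum k w t)%Z, 2 * n'.+1%:Z <= wsum k w t,
        ~~ unpaired w m id (fun i => i + m)%N t &
        ~~ odd m -> unpaired w m (fun i => 2 * i)%N (fun i => (2 * i).+1) t].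
Proof.
move=> nE k0 bm b_odd; have m0 : (0 < m)%N by lia.
have ltn_lo i : (i < m)%N -> (i < n'.+1)%N by lia.
have ltn_hi i : (i < m)%N -> (i + m < n'.+1)%N by lia.
have [x xm mx] := exists_shift_dvd k m0.
(* The neighbour of [x] in its adjacent pair; keeping its weight 0 makes that pair a half block when
   m is even. *)
pose x' := if odd x then x.-1 else x.+1.
have [l [sl ul al xl x'l]] := @exists_avoiding_values m b x x' bm.
pose la := x :: (x + m)%N :: [seq (y + m)%N | y <- l].
have lm y : y \in l -> (y < m)%N by move/(allP al).
have ml i : ((i + m)%N \in [seq (y + m)%N | y <- l]) = (i \in l).
  by apply: mem_map => u v /addIn.
have lo i : (i < m)%N -> (i \in la ++ l) = (i == x) || (i \in l).
  move=> im; rewrite mem_cat !inE (_ : (i == x + m)%N = false); last by lia.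
  rewrite (_ : (i \in map _ _) = false) ?orbF //.
  by apply/mapP => -[y _]; lia.
have hi i : (i < m)%N -> ((i + m)%N \in la ++ l) = (i == x) || (i \in l).
  move=> im; rewrite mem_cat !inE ml eqn_add2r (_ : (i + m == x)%N = false); last by lia.
  rewrite [X in _ || X](_ : _ = false) ?orbF //.
  by apply/negP => /lm; lia.
have uniql : uniq (la ++ l).
  rewrite cat_uniq ul andbT /= ml xl map_inj_uniq ?ul; last by move=> u v /addIn.
  rewrite !inE !andbT; apply/andP; split.
    by rewrite negb_or; apply/andP; split; [lia|apply/mapP => -[y _]; lia].
  apply/hasPn => y yl; have ym := lm y yl; rewrite !inE.
  rewrite !negb_or; apply/and3P; split; [by apply: contraNneq xl => <-|lia|].
  by apply/mapP => -[z _]; lia.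
have all_l : all (fun y => y < n'.+1)%N (la ++ l).
  apply/allP => y; rewrite mem_cat !inE -!orbA => /or4P[/eqP ->|/eqP ->| |/lm]; try lia.
  by case/mapP => z /lm zm ->; lia.
have [t [D0 wt0]] := exists_perm_of_values k uniql all_l.
move: D0 wt0; rewrite /= size_map sl -[b.+2]addn2 => D0 wt0.
have sm s : sumn [seq (y + m)%N | y <- s] = (sumn s + size s * m)%N.
  by elim: s => //= y s ->; lia.
have {}D0 : wsum k (ab_weight (b + 2) b) t = 2 * (x + k)%N%:Z + (b + 1)%N%:Z * m%:Z.
  by rewrite D0 sm sl; lia.
have /dvdnP[z zE] := mx; have z0 : (0 < z)%N by case: z zE => //; lia.
pose c := (b + 1)./2; have cE : (b + 1)%N = (2 * c)%N by lia.
have {}D0 : wsum k (ab_weight (b + 2) b) t = (z + c)%N%:Z * n'.+1%:Z.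
  by rewrite D0 zE nE cE; lia.
exists t; split.
- by rewrite D0 dvdz_mull.
- by rewrite D0 ler_wpM2r //; lia.
- apply/pairedP => i im.
  by rewrite (wt0 i (ltn_lo _ im)) (wt0 _ (ltn_hi _ im)) lo // hi.
- move=> m_even; have im : (x %/ 2 < m)%N by lia.
  apply/existsP; exists (Ordinal im); rewrite /half_block /=.
  have x'm : (x' < m)%N by rewrite /x'; case: ifP; lia.
  have xin : word (ab_weight (b + 2) b) t x != 0.
    by rewrite (wt0 x (ltn_lo _ xm)) lo ?eqxx.
  have x'in : word (ab_weight (b + 2) b) t x' == 0.
    rewrite (wt0 x' (ltn_lo _ x'm)) lo // (negbTE x'l) orbF.
    by rewrite /x'; case: ifP; lia.
  case: (boolP (odd x)) => ox.
    have E1 : (2 * (x %/ 2))%N = x' by rewrite /x' ox; lia.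
    have -> : (2 * (x %/ 2)).+1 = x by lia.
    by rewrite E1 x'in (negbTE xin).
  have -> : (2 * (x %/ 2)).+1 = x' by rewrite /x' (negbTE ox); lia.
  have -> : (2 * (x %/ 2))%N = x by lia.
  by rewrite x'in (negbTE xin).
Qed.

Lemma zero_bound_diff2_even n' m k b :
  (0 < k)%N -> (0 < b)%N -> ((b + 2) + b < n'.+1)%N -> n'.+1 = (2 * m)%N ->
  (2 * m * #|[set t | wsum k (@ab_weight n'.+1 (b + 2) b) t == 0]|
     < #|{: 'S_n'.+1}|)%N.
Proof.
move=> k0 b0 bn nE.
have w3 := @ab_weight3 n'.+1 (b + 2) b.
have ws : \sum_(i < n'.+1) ab_weight (b + 2) b i = 2.
  by rewrite sum_ab_weight1; lia.
(* For b even, the number b + 1 of blocks of nonzero weights is odd in paired words, and the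
   identity is paired because b + 2 and 2b + 2 are even. *)
case: (boolP (odd b)) => b_odd; last first.
  apply: (zero_bound_odd_pairs k w3 ws nE (e := (b + 1)%N%:Z) (t0 := 1%g)).
  - by rewrite sum_ab_weight_sqr; lia.
  - by lia.
  - apply/pairedP => i im; rewrite /word !perm1 /ab_weight !inordK; lia.
have bm : (b + 2 <= m)%N by lia.
have [t0 [nD D0 Yt Xt]] := exists_antipodal_perm nE k0 bm b_odd.
case: (boolP (odd m)) => m_odd.
  exact: (zero_bound_antipodal w3 ws nE m_odd Yt nD D0).
have mE : m = (2 * m./2)%N by lia.
apply: (zero_bound_adjacent w3 ws nE mE (Xt m_odd) nD); lia.
Qed.

(** * From permutations back to bijections *)

(** The inverse appears because [t] maps values to positions; [rshift] adds [k] to the value. *)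
Definition bijection_of_perm n k (t : 'S_n) : {ffun 'I_n -> 'I_(n + k)} :=
  [ffun i => cast_ord (addnC k n) (rshift k ((t^-1)%g i))].

Lemma bijection_of_permE n k (t : 'S_n) i :
  (bijection_of_perm k t i : nat) = (k + (t^-1)%g i)%N.
Proof. by rewrite ffunE. Qed.

Lemma bijection_of_perm_inj n k : injective (@bijection_of_perm n k).
Proof.
move=> t u E; apply: invg_inj; apply/permP => i; apply: val_inj.
have := bijection_of_permE k t i; rewrite E bijection_of_permE.
by move/addnI.
Qed.

Lemma bijectionsE n k :
  bijections n k = @bijection_of_perm n k @: [set: 'S_n].
Proof.
apply/setP => s; rewrite inE; apply/andP/imsetP => [[/injectiveP s_inj /eqP sE]|[t _ ->]].
  have ks i : (k <= s i)%N.
    have : s i \in s @: [set: 'I_n] by apply: imset_f; rewrite inE.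
    by rewrite sE inE.
  have lts i : (s i - k < n)%N by have := ltn_ord (s i); have := ks i; lia.
  have u_inj : injective (fun i => Ordinal (lts i)).
    move=> i j /(congr1 val) /= E; apply: s_inj; apply: val_inj => /=.
    by rewrite -(subnK (ks i)) E subnK.
  exists (perm u_inj)^-1%g; rewrite ?inE //.
  apply/ffunP => i; apply: val_inj; rewrite /= bijection_of_permE invgK permE /=.
  by rewrite subnKC.
split.
  apply/injectiveP => i j /(congr1 val) /=.
  by rewrite !bijection_of_permE => /addnI /val_inj /perm_inj.
apply/eqP/setP => j; rewrite inE; apply/imsetP/idP => [[i _ ->]|kj].
  by rewrite bijection_of_permE leq_addr.
have jn : (j - k < n)%N by have := ltn_ord j; lia.
exists (t (Ordinal jn)); rewrite ?inE //.
by apply: val_inj; rewrite /= bijection_of_permE permK /= subnKC.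
Qed.

Lemma Dstat_wsum n' k a b (t : 'S_n'.+1) :
  Dstat a b (bijection_of_perm k t) = wsum k (ab_weight a b) t.
Proof.
rewrite /Dstat /wsum [RHS](reindex_inj (@perm_inj _ t^-1%g)) /=.
rewrite [X in X - _ = _]big_mkcond [X in _ - X = _]big_mkcond -sumrB.
apply: eq_bigr => i _; rewrite permKV bijection_of_permE addnC /ab_weight.
by case: (i < a)%N; case: (a <= i < a + b)%N; rewrite /=; ring.
Qed.

Theorem theorem14 (k n a b : nat) (hk : (0 < k)%N) (hn : (0 < n)%N)
    (ha : (0 < a)%N) (hb : (0 < b)%N)
    (hab : a = (b + 2)%N \/ a = (b + 1)%N) (habn : (a + b < n)%N) :
  unif_pr (bijections n k) (fun s => Dstat a b s == 0) < 1 / n%:R.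
Proof.
case: n hn habn => // n' _ habn; rewrite /unif_pr.
have -> : #|[set x in bijections n'.+1 k | Dstat a b x == 0]| =
    #|[set t | wsum k (@ab_weight n'.+1 a b) t == 0]|.
  rewrite -(card_imset _ (@bijection_of_perm_inj n'.+1 k)); apply: eq_card => s.
  rewrite inE bijectionsE; apply/andP/imsetP => [[/imsetP[t _ ->] D0]|[t]].
    by exists t; rewrite // inE -Dstat_wsum.
  by rewrite inE -Dstat_wsum => D0 ->; rewrite imset_f ?inE.
have -> : #|bijections n'.+1 k| = #|{: 'S_n'.+1}|.
  by rewrite bijectionsE card_imset ?cardsT //; apply: bijection_of_perm_inj.
suff H : (n'.+1 * #|[set t | wsum k (@ab_weight n'.+1 a b) t == 0%R]|
    < #|{: 'S_n'.+1}|)%N.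
  rewrite ltr_pdivrMr ?ltr0n; last by rewrite (leq_trans _ H).
  by rewrite mulrAC ltr_pdivlMr ?ltr0n // mul1r -natrM ltr_nat mulnC.
case: hab => aE; rewrite aE in habn *; last exact: zero_bound_diff1.
case: (boolP (odd n'.+1)) => n_odd; first exact: zero_bound_diff2_odd.
have nE : n'.+1 = (2 * n'.+1./2)%N by lia.
have := zero_bound_diff2_even hk hb habn nE; rewrite -nE; exact.
Qed.
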